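(* Let $P\ge 1$ be an integer and let $\mathcal{R}$ be a finite nonempty set. For each $p\in\{1,\dots,P\}$ let $\lambda_p>0$ and $\mu_p>0$ be real numbers, and for each $r\in\mathcal{R}$ let $K^r>0$ and $z_p^r>0$ be real numbers with $z_p^r\le K^r$. Put $A_p=\lambda_p/\mu_p$, $w_p=\lambda_p/\sum_{p'=1}^P\lambda_{p'}$ and $N_p=\left\lfloor \min_{r\in\mathcal{R}} K^r/z_p^r\right\rfloor$. Let $\mathcal{V}_1,\dots,\mathcal{V}_P$ be pairwise disjoint finite sets with $|\mathcal{V}_p|=N_p$, and let $\mathcal{V}=\bigcup_{p=1}^P\mathcal{V}_p$. Define $f:2^{\mathcal{V}}\to[0,1]$ by $$f(\mathcal{S})=\sum_{p=1}^P w_p\,\bar B_p(\mathcal{S}\cap\mathcal{V}_p),\qquad \bar B_p(\mathcal{S}_p)=1-\frac{A_p^{|\mathcal{S}_p|}/|\mathcal{S}_p|!}{\sum_{i=0}^{|\mathcal{S}_p|}A_p^i/i!}\quad\text{for }\mathcal{S}_p\subseteq\mathcal{V}_p.$$ Then $f$ is monotone and sub-modular.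
   Context: For a set function $f$ on the subsets of a finite set $\mathcal{V}$, for $\mathcal{S}\subseteq\mathcal{V}$ and $v\in\mathcal{V}$, the marginal gain is $\Delta_f(v|\mathcal{S})=f(\mathcal{S}\cup\{v\})-f(\mathcal{S})$. The function $f$ is called sub-modular if $\Delta_f(v|\mathcal{B})\le\Delta_f(v|\mathcal{A})$ for all $\mathcal{A}\subseteq\mathcal{B}\subseteq\mathcal{V}$ and all $v\in\mathcal{V}\setminus\mathcal{B}$. It is called monotone if $\Delta_f(v|\mathcal{S})\ge 0$ for all $\mathcal{S}\subseteq\mathcal{V}$ and all $v\in\mathcal{V}$. Interpretation: $p$ indexes service providers sharing an edge node, $\mathcal{R}$ is the set of resource types, $K^r$ is the total capacity of resource $r$, and $z_p^r$ is the amount of resource $r$ required by one session of provider $p$. Users of provider $p$ arrive at rate $\lambda_p$ and are served at rate $\mu_p$. $\mathcal{V}_p$ is the set of candidate sessions of provider $p$, $N_p$ being the number of sessions that fit if provider $p$ gets all resources. $1-\bar B_p(\mathcal{S}_p)$ is the Erlang blocking probability with $|\mathcal{S}_p|$ servers and offered load $A_p$. *)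

(* Defs.v *)
From HB Require Import structures.
From mathcomp Require Import all_boot all_order all_algebra.
From mathcomp Require Import reals.

Set Implicit Arguments.
Unset Strict Implicit.
Unset Printing Implicit Defensive.

Import Order.TTheory GRing.Theory Num.Theory.
Local Open Scope ring_scope.

Section SetFunctions.
Variables (R : numDomainType) (T : finType).

Definition marginal_gain (f : {set T} -> R) (v : T) (S : {set T}) : R :=
  f (S :|: [set v]) - f S.

(* A set function on the subsets of [V] is represented by a total function on
   [{set T}], of which only the values at subsets of [V] are constrained. *)
Definition submodular_on (V : {set T}) (f : {set T} -> R) : Prop :=
  forall (A B : {set T}) (v : T),
    A \subset B -> B \subset V -> v \in V :\: B ->
    marginal_gain f v B <= marginal_gain f v A.

Definition monotone_on (V : {set T}) (f : {set T} -> R) : Prop :=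
  forall (S : {set T}) (v : T),
    S \subset V -> v \in V -> 0 <= marginal_gain f v S.

End SetFunctions.

(* Blocking probability of an Erlang loss system with [n] servers and offered
   load [a]. *)
Definition erlangB (R : fieldType) (a : R) (n : nat) : R :=
  (a ^+ n / n`!%:R) / (\sum_(i < n.+1) a ^+ i / i`!%:R).

(* The minimum over the nonempty type [Res] is taken as an iterated binary
   minimum whose initial value is the ratio at an arbitrary [r0 : Res], so that
   the result does not depend on [r0]. *)
Definition max_sessions (R : realType) (Res : finType) (r0 : Res)
    (K z : Res -> R) : int :=
  Num.floor (\big[Num.min/(K r0 / z r0)]_(r : Res) (K r / z r)).

Section Objective.
Variables (R : realType) (P : nat) (lambda mu : 'I_P -> R).

Definition offered_load (p : 'I_P) : R := lambda p / mu p.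

Definition weight (p : 'I_P) : R := lambda p / \sum_(q < P) lambda q.

Variables (T : finType) (V : 'I_P -> {set T}).

Definition Bbar (p : 'I_P) (S : {set T}) : R :=
  1 - erlangB (offered_load p) #|S|.

Definition objective (S : {set T}) : R :=
  \sum_(p < P) weight p * Bbar p (S :&: V p).

End Objective.

(* Main.v *)
Require Import Defs.
From HB Require Import structures.
From mathcomp Require Import all_boot all_order all_algebra.
From mathcomp Require Import reals.
From mathcomp Require Import ring lra.

Set Implicit Arguments.
Unset Strict Implicit.
Unset Printing Implicit Defensive.

Import Order.TTheory GRing.Theory Num.Theory.
Local Open Scope ring_scope.

(** Since [|S :&: V p|] grows by at most one when an element is added to [S],
    everything reduces to the Erlang blocking probability B_n being
    nonincreasing and convex in the number n of servers.  With
    u_n = n + 1 + a B_n - a, the classical recurrence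
    B_(n+1) = a B_n / (n + 1 + a B_n) becomes
    u_(n+1) = ((n + 2) u_n + a) / (u_n + a), and
    B_n - B_(n+1) = B_(n+1) u_n / a.  Monotonicity is then u_n > 0, while
    convexity at n amounts to the quadratic inequality
    (m + 1 + a) u^2 + a (a - m) u - a^2 >= 0 for m = n + 1 and u = u_n, which
    is preserved by the recurrence. *)

Definition erlang_slack (R : fieldType) (a : R) (n : nat) : R :=
  n.+1%:R + a * erlangB a n - a.

Definition slack_quad (R : pzRingType) (a m u : R) : R :=
  (m + 1 + a) * u ^+ 2 + a * (a - m) * u - a ^+ 2.

(** * Monotonicity and convexity of the Erlang blocking probability *)

Section ErlangB.
Variables (R : realFieldType) (a : R).
Hypothesis a_gt0 : 0 < a.

Let term_gt0 n : 0 < a ^+ n / n`!%:R.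
Proof. by rewrite divr_gt0 ?exprn_gt0// ltr0n fact_gt0. Qed.

Let sum_gt0 n : 0 < \sum_(i < n.+1) a ^+ i / i`!%:R.
Proof.
rewrite big_ord_recr /= ltr_wpDl //.
by apply: sumr_ge0 => i _; exact: ltW.
Qed.

Lemma erlangB0 : erlangB a 0 = 1.
Proof. by rewrite /erlangB big_ord1 fact0 expr0 !divr1. Qed.

Lemma erlangB_gt0 n : 0 < erlangB a n.
Proof. exact: divr_gt0. Qed.

Lemma erlangBS n :
  erlangB a n.+1 = a * erlangB a n / (n.+1%:R + a * erlangB a n).
Proof.
rewrite /erlangB [in LHS]big_ord_recr /=.
have s0 := sum_gt0 n; have t0 := term_gt0 n.
set s := \sum_(i < n.+1) _ in s0 *.
have -> : a ^+ n.+1 / n.+1`!%:R = a / n.+1%:R * (a ^+ n / n`!%:R).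
  by rewrite factS natrM exprS invfM mulrACA.
set t := a ^+ n / n`!%:R in t0 *.
have m0 : 0 < n.+1%:R :> R by rewrite ltr0n.
move: (n.+1%:R) m0 => m m0.
(* Both sides reduce to [a * t / (m * s + a * t)], so [field] needs this denominator to be
   nonzero. *)
have h2 : 0 < m * s + a * t by apply: addr_gt0; apply: mulr_gt0.
by field; rewrite !gt_eqF.
Qed.

Lemma erlangB_slackS n :
  erlangB a n.+1 = a * erlangB a n / (erlang_slack a n + a).
Proof. by rewrite erlangBS subrK. Qed.

Lemma erlang_slack_add_gt0 n : 0 < erlang_slack a n + a.
Proof. by rewrite subrK addr_gt0 ?ltr0n// mulr_gt0// erlangB_gt0. Qed.

Lemma erlang_slackS n : erlang_slack a n.+1 =
  ((n.+1%:R + 1) * erlang_slack a n + a) / (erlang_slack a n + a).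
Proof.
have ua := erlang_slack_add_gt0 n.
rewrite {1}/erlang_slack erlangB_slackS.
have -> : a * erlangB a n = erlang_slack a n - n.+1%:R + a.
  by rewrite /erlang_slack; ring.
by rewrite -[n.+2]addn1 natrD; field; rewrite gt_eqF.
Qed.

(** Induction from u_0 = 1: the recurrence for u_n has only positive coefficients. *)
Lemma erlang_slack_gt0 n : 0 < erlang_slack a n.
Proof.
elim: n => [|n IHn]; first by rewrite /erlang_slack erlangB0 mulr1 addrK.
rewrite erlang_slackS divr_gt0 ?erlang_slack_add_gt0//.
by rewrite addr_gt0// mulr_gt0// natr1 ltr0n.
Qed.

(** Solved for B_n, the recurrence reads B_n = B_(n+1) (u_n + a) / a. *)
Lemma erlangB_subS n : erlangB a n - erlangB a n.+1 =
  erlangB a n.+1 * erlang_slack a n / a.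
Proof.
rewrite erlangB_slackS; have := erlang_slack_add_gt0 n => ua.
by field; rewrite !gt_eqF.
Qed.

Lemma erlangB_nonincreasing : {homo erlangB a : m n / (m <= n)%N >-> n <= m}.
Proof.
apply: homo_leq => [//|x y z xy yz|n]; first exact: le_trans yz xy.
rewrite -subr_ge0 erlangB_subS; apply/ltW.
apply: divr_gt0 => //; apply: mulr_gt0; first exact: erlangB_gt0.
exact: erlang_slack_gt0.
Qed.

Lemma erlangB_le1 n : erlangB a n <= 1.
Proof. by rewrite -erlangB0 erlangB_nonincreasing. Qed.

(* Writing D = a m - (m + 1)(m + 2) and E = a (m + 2), the product F of the new
   quadratic by (u + a)^2 is
   m a * slack_quad a m u + ((m + 1) u + a) (E - D u), which settles D u <= E.
   Otherwise D > 0, and F = alpha u^2 + beta u + gamma with alpha, beta >= 0, so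
   D F >= beta (D u) + gamma D >= beta E + gamma D >= 0. *)
Lemma slack_quad_step (m u : R) : 1 <= m -> 0 < u ->
  0 <= slack_quad a m u ->
  0 <= slack_quad a (m + 1) (((m + 1) * u + a) / (u + a)).
Proof.
move=> m1 u0 Q0; have m0 : 0 < m by lra.
have ua : 0 < u + a by rewrite addr_gt0.
pose D := a * m - (m + 1) * (m + 2); pose E := a * (m + 2).
pose alpha := (m + 1) ^+ 2 * (m + 2) + m * a ^+ 2.
pose beta := a * (m * (a * (a - (m + 1))) + 2 * (m + 1) * (m + 2)).
pose gamma := a ^+ 2 * (m + 2 - a * m).
pose F := alpha * u ^+ 2 + beta * u + gamma.
have -> : slack_quad a (m + 1) (((m + 1) * u + a) / (u + a)) =
    F / (u + a) ^+ 2.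
  rewrite /slack_quad /F /alpha /beta /gamma.
  by field; rewrite gt_eqF.
apply: divr_ge0; last exact: sqr_ge0.
have [DuE|EDu] := leP (D * u) E.
  have -> : F = m * a * slack_quad a m u + ((m + 1) * u + a) * (E - D * u).
    by rewrite /F /slack_quad /alpha /beta /gamma /D /E; ring.
  apply: addr_ge0; first by rewrite !mulr_ge0// ltW.
  rewrite mulr_ge0 ?subr_ge0//; apply: addr_ge0; last exact: ltW.
  by rewrite mulr_ge0; lra.
have D0 : 0 < D.
  rewrite -(pmulr_lgt0 _ u0); apply: lt_trans EDu.
  by rewrite mulr_gt0//; lra.
(* [m * (a - (m + 1))] exceeds [D] by [2 * (m + 1)]; this bound is what makes [beta] nonnegative. *)
have am1 : 0 <= a - (m + 1).
  rewrite -(pmulr_rge0 _ m0); apply: le_trans (ltW D0) _.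
  by rewrite /D; lra.
have mm0 : 0 <= (m + 1) * (m + 2) by rewrite mulr_ge0; lra.
have beta0 : 0 <= beta.
  rewrite mulr_ge0 ?addr_ge0 ?(ltW a_gt0)//.
    by rewrite !mulr_ge0// ltW.
  by rewrite -mulrA mulr_ge0.
have alpha0 : 0 <= alpha.
  by rewrite addr_ge0 ?mulr_ge0 ?sqr_ge0//; lra.
rewrite -(pmulr_rge0 _ D0).
(* The last summand is [beta * E + gamma * D], in which all negative terms cancel. *)
have -> : D * F = D * alpha * u ^+ 2 + (beta * (D * u - E)
    + a ^+ 2 * (2 * m * a ^+ 2 + a * m * (m + 2)
                + (m + 1) * (m + 2) * (m + 2))).
  by rewrite /F /beta /gamma /D /E; ring.
apply: addr_ge0; first by rewrite !mulr_ge0 ?sqr_ge0// ltW.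
apply: addr_ge0; first by rewrite mulr_ge0// subr_ge0 ltW.
rewrite mulr_ge0 ?sqr_ge0// !addr_ge0//; rewrite !mulr_ge0 ?sqr_ge0//; lra.
Qed.

Lemma slack_quad_erlang_ge0 n : 0 <= slack_quad a n.+1%:R (erlang_slack a n).
Proof.
elim: n => [|n IHn].
  rewrite /erlang_slack erlangB0 mulr1 addrK /slack_quad.
  by have -> : (1 + 1 + a) * 1 ^+ 2 + a * (a - 1) * 1 - a ^+ 2 = 2 by ring.
rewrite erlang_slackS -[n.+2]addn1 natrD slack_quad_step ?erlang_slack_gt0//.
by rewrite ler1n.
Qed.

Lemma erlangB_convexS n :
  erlangB a n.+1 - erlangB a n.+2 <= erlangB a n - erlangB a n.+1.
Proof.
rewrite !erlangB_subS ler_pM2r ?invr_gt0// (erlangB_slackS n.+1).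
have ua := erlang_slack_add_gt0 n; have va := erlang_slack_add_gt0 n.+1.
(* Isolating the common factor B_(n+1) reduces the claim to a u_(n+1) / (u_(n+1) + a) <= u_n. *)
have -> : a * erlangB a n.+1 / (erlang_slack a n.+1 + a) * erlang_slack a n.+1 =
    erlangB a n.+1 * (erlang_slack a n.+1 * a / (erlang_slack a n.+1 + a)).
  by ring.
rewrite ler_pM2l ?erlangB_gt0// ler_pdivrMr// mulrC -subr_ge0.
have Q0 := slack_quad_erlang_ge0 n.
have -> : erlang_slack a n * (erlang_slack a n.+1 + a)
    - a * erlang_slack a n.+1 =
    slack_quad a n.+1%:R (erlang_slack a n) / (erlang_slack a n + a).
  by rewrite erlang_slackS /slack_quad; field; rewrite gt_eqF.
by rewrite divr_ge0// ltW.
Qed.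

Lemma erlangB_convex : {homo (fun n => erlangB a n - erlangB a n.+1) :
  m n / (m <= n)%N >-> n <= m}.
Proof.
apply: homo_leq => [//|x y z xy yz|n]; first exact: le_trans yz xy.
exact: erlangB_convexS.
Qed.

End ErlangB.

Lemma cardsIU1 (T : finType) (S W : {set T}) (v : T) :
  #|(S :|: [set v]) :&: W| = ((v \in W) && (v \notin S) + #|S :&: W|)%N.
Proof.
rewrite setIUl; have [vW|vW] /= := boolP (v \in W); last first.
  have /disjoint_setI0 -> : [disjoint [set v] & W] by rewrite disjoints1.
  by rewrite setU0.
have /setIidPl -> : [set v] \subset W by rewrite sub1set.
by rewrite setUC cardsU1 inE vW andbT.
Qed.

(** * Marginal gains of the weighted objective *)

Section Objective.
Variables (R : realType) (P : nat) (lambda mu : 'I_P -> R).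
Hypotheses (hlambda : forall p, 0 < lambda p) (hmu : forall p, 0 < mu p).
Variables (T : finType) (V : 'I_P -> {set T}).

Let load_gt0 p : 0 < offered_load lambda mu p.
Proof. exact: divr_gt0. Qed.

Lemma weight_ge0 p : 0 <= weight lambda p.
Proof. by rewrite divr_ge0 ?sumr_ge0// => *; exact: ltW. Qed.

Lemma sum_weight : (0 < P)%N -> \sum_(p < P) weight lambda p = 1.
Proof.
move=> P0; rewrite -mulr_suml divff// gt_eqF//.
rewrite (bigD1 (Ordinal P0))//= ltr_wpDr// sumr_ge0// => *; exact: ltW.
Qed.

Lemma objective_itv (S : {set T}) : (0 < P)%N ->
  0 <= objective lambda mu V S <= 1.
Proof.
move=> P0; apply/andP; split.
  apply: sumr_ge0 => p _; rewrite mulr_ge0 ?weight_ge0// subr_ge0.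
  exact: erlangB_le1.
rewrite -(sum_weight P0); apply: ler_sum => p _.
by rewrite ler_piMr ?weight_ge0// gerBl ltW// erlangB_gt0.
Qed.

(** The constants 1 cancel; the boolean, coerced to 0 or 1, selects either a zero term or a
    difference of consecutive blocking probabilities. *)
Lemma marginal_gain_objective (S : {set T}) v :
  marginal_gain (objective lambda mu V) v S =
  \sum_(p < P) weight lambda p *
    (erlangB (offered_load lambda mu p) #|S :&: V p| -
     erlangB (offered_load lambda mu p)
       ((v \in V p) && (v \notin S) + #|S :&: V p|)).
Proof.
rewrite /marginal_gain /objective -sumrB; apply: eq_bigr => p _.
by rewrite /Bbar cardsIU1; ring.
Qed.

Lemma objective_monotone (W : {set T}) : monotone_on W (objective lambda mu V).
Proof.
move=> S v _ _; rewrite marginal_gain_objective; apply: sumr_ge0 => p _.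
rewrite mulr_ge0 ?weight_ge0// subr_ge0.
by apply: erlangB_nonincreasing => //; exact: leq_addl.
Qed.

Lemma objective_submodular (W : {set T}) :
  submodular_on W (objective lambda mu V).
Proof.
move=> A B v AB _; rewrite inE => /andP[vB _].
have vA : v \notin A by apply: contra vB; exact: (subsetP AB).
rewrite !marginal_gain_objective vA vB; apply: ler_sum => p _.
rewrite ler_wpM2l ?weight_ge0// andbT.
(* Outside [V p] both gains vanish; inside, convexity compares the counts [#|A :&: V p|] and
   [#|B :&: V p|]. *)
case: (v \in V p); last by rewrite !subrr.
by apply: erlangB_convex => //; rewrite subset_leq_card// setSI.
Qed.

End Objective.

Theorem mainTheorem1 (R : realType) (P : nat) (hP : (1 <= P)%N)
    (Res : finType) (r0 : Res)
    (lambda mu : 'I_P -> R) (K : Res -> R) (z : 'I_P -> Res -> R)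
    (hlambda : forall p, 0 < lambda p)
    (hmu : forall p, 0 < mu p)
    (hK : forall r, 0 < K r)
    (hz : forall p r, 0 < z p r)
    (hzK : forall p r, z p r <= K r)
    (T : finType) (V : 'I_P -> {set T})
    (hdisj : forall p q, p != q -> [disjoint V p & V q])
    (hcard : forall p, #|V p|%:Z = max_sessions r0 K (z p)) :
  (forall S : {set T}, S \subset \bigcup_(p < P) V p ->
     0 <= objective lambda mu V S <= 1) /\
  monotone_on (\bigcup_(p < P) V p) (objective lambda mu V) /\
  submodular_on (\bigcup_(p < P) V p) (objective lambda mu V).
Proof.
split; first by move=> S _; exact: objective_itv.
by split; [exact: objective_monotone|exact: objective_submodular].
Qed.
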